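(* Let $F:[0,L)\times(0,\pi)\to[0,L)\times(0,\pi)$ be a deterministic billiard map, with invariant measure $\lambda\times\mu$, where $\lambda$ is normalized Lebesgue measure on $[0,L)$ and $\mu(B)=\frac12\int_B\sin\theta\,d\theta$. Let $0<\alpha<\pi/6$ and let $\overline T(s,\theta)=(s,T_i(\theta))$ with probability $p_i(\theta)$, $i=1,\dots,4$, where $T_i,p_i$ are the maps and probabilities of the Feres Random Map with parameter $\alpha$. Then the random billiard map $\overline F=F\circ\overline T$, i.e. $\overline F(s,\theta)=F(s,T_i(\theta))$ with probability $p_i(\theta)$, has $\lambda\times\mu$ as an invariant measure.
   Context: Deterministic billiard map. A particle moves freely in the planar region enclosed by a plane, simple, closed, regular, smooth, oriented curve $\gamma$ of length $L$, with strictly positive curvature, parametrized by arc length $s\in[0,L)$, reflecting elastically (angle of incidence equals angle of reflection) at $\gamma$. The state just after an impact is $(s,\theta)$, where $\gamma(s)$ is the impact point and $\theta\in(0,\pi)$ the angle, measured counter-clockwise, from $\gamma'(s)$ to the outgoing trajectory. The billiard map $F$ sends $(s,\theta)$ to the state just after the next impact. It preserves the (Liouville) probability measure $\lambda\times\mu$. Feres Random Map. Fix $0<\alpha<\pi/6$. Put $T_1(\theta)=\theta+2\alpha$, $T_2(\theta)=-\theta+2\pi-4\alpha$, $T_3(\theta)=\theta-2\alpha$, $T_4(\theta)=-\theta+4\alpha$, and $u_a(\theta)=\frac12\left(1+\frac{\tan a}{\tan\theta}\right)$ (with $1/\tan(\pi/2)=0$). Define functions $p_i:[0,\pi]\to[0,1]$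 by: $p_1(\theta)=1$ on $[0,\alpha)$, $u_\alpha(\theta)$ on $[\alpha,\pi-3\alpha)$, $2\cos(2\alpha)u_{2\alpha}(\theta)$ on $[\pi-3\alpha,\pi-2\alpha)$, $0$ on $[\pi-2\alpha,\pi]$; $p_2(\theta)=0$ on $[0,\pi-3\alpha)$, $u_\alpha(\theta)-2\cos(2\alpha)u_{2\alpha}(\theta)$ on $[\pi-3\alpha,\pi-2\alpha)$, $u_\alpha(\theta)$ on $[\pi-2\alpha,\pi-\alpha)$, $0$ on $[\pi-\alpha,\pi]$; $p_3(\theta)=0$ on $[0,2\alpha)$, $2\cos(2\alpha)u_{2\alpha}(-\theta)$ on $[2\alpha,3\alpha)$, $u_\alpha(-\theta)$ on $[3\alpha,\pi-\alpha)$, $1$ on $[\pi-\alpha,\pi]$; $p_4(\theta)=0$ on $[0,\alpha)$, $u_\alpha(-\theta)$ on $[\alpha,2\alpha)$, $u_\alpha(-\theta)-2\cos(2\alpha)u_{2\alpha}(-\theta)$ on $[2\alpha,3\alpha)$, $0$ on $[3\alpha,\pi]$. The Feres Random Map $T$ sends $\theta$ to $T_i(\theta)$ with probability $p_i(\theta)$, $i=1,2,3,4$. Invariance. If a random map on a measurable space $X$ sends $x$ to $R_i(x)$ with probability $q_i(x)$ ($i=1,\dots,N$), a measure $m$ on $X$ is invariant for it if $m(A)=\sum_{i=1}^N\int_{R_i^{-1}(A)}q_i(x)\,dm(x)$ for every measurable $A$ (points with $q_i(x)=0$ contribute nothing, so $R_i$ need only be defined where $q_i>0$). Here $X=[0,L)\times(0,\pi)$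 with Borel sets. *)

(* Defs.v *)
From HB Require Import structures.
From mathcomp Require Import all_boot all_order all_algebra.
From mathcomp Require Import all_classical all_reals all_analysis.
From mathcomp Require Import measurable_realfun.

Set Implicit Arguments.
Unset Strict Implicit.
Unset Printing Implicit Defensive.

Import Order.TTheory GRing.Theory Num.Theory.
Import numFieldNormedType.Exports.

Local Open Scope classical_set_scope.
Local Open Scope ring_scope.

Section billiard.
Context {R : realType}.
Implicit Types (gamma : R -> R * R) (s t theta L : R) (v w p : R * R).

Definition tangent gamma s : R * R :=
  (derive1 (fst \o gamma) s, derive1 (snd \o gamma) s).

(* det(gamma'(s), gamma''(s)): the signed curvature when s is arc length. *)
Definition curvature gamma s : R :=
  derive1 (fst \o gamma) s * derive1n 2 (snd \o gamma) s
  - derive1 (snd \o gamma) s * derive1n 2 (fst \o gamma) s.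

(* A closed curve on [0, L) is given through its L-periodic extension to the
   real line, so smoothness on the line includes smooth closing at the base
   point. With the sign convention of [curvature], [bc_curvature] orients the
   curve counter-clockwise: the enclosed region is on its left, which is where
   directions with angle in (0, pi) point. *)
Record billiard_curve L gamma : Prop := BilliardCurve {
  bc_smooth : forall n s, derivable (derive1n n (fst \o gamma)) s 1 /\
                          derivable (derive1n n (snd \o gamma)) s 1 ;
  bc_closed : forall s, gamma (s + L) = gamma s ;
  bc_simple : {in `[0, L[ &, injective gamma} ;
  bc_arc_length : forall s,
    (tangent gamma s).1 ^+ 2 + (tangent gamma s).2 ^+ 2 = 1 ;
  bc_curvature : forall s, 0 < curvature gamma s }.

(* The points off the curve whose connected component in the complement of the
   curve is bounded. *)
Definition enclosed gamma : set (R * R) :=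
  [set p | (~` range gamma) p /\
           bounded_set (connected_component (~` range gamma) p)].

(* gamma'(s) rotated counter-clockwise by theta. *)
Definition direction gamma s theta : R * R :=
  let: (a, b) := tangent gamma s in
  (cos theta * a - sin theta * b, sin theta * a + cos theta * b).

(* Reflection of v in the line spanned by the unit vector w. *)
Definition reflect_in w v : R * R :=
  (2 * (v.1 * w.1 + v.2 * w.2)) *: w - v.

Definition phase_space L : set (R * R) := `[0, L[ `*` `]0, pi[.

(* The values of F outside the phase space are irrelevant. As [enclosed] is
   disjoint from the curve, the free-flight condition makes gamma(s') the first
   impact after leaving gamma(s). *)
Definition billiard_map L gamma (F : R * R -> R * R) : Prop :=
  forall s theta, phase_space L (s, theta) ->
    let v := direction gamma s theta in
    let: (s', theta') := F (s, theta) in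
    [/\ phase_space L (s', theta'),
        exists t, [/\ 0 < t, gamma s' = gamma s + t *: v &
          forall u, 0 < u < t -> enclosed gamma (gamma s + u *: v)] &
        direction gamma s' theta' = reflect_in (tangent gamma s') v].

End billiard.

Section arc_length_prob.
Context {R : realType} (L : {posnum R}).

Definition arc_length_prob : set (measurableTypeR R) -> \bar R :=
  mscale (L%:num^-1)%:nng
    (mrestr lebesgue_measure (measurable_itv `[0, L%:num[)).

HB.instance Definition _ := Measure.on arc_length_prob.

Let arc_length_prob_setT : arc_length_prob setT = 1%:E.
Proof.
rewrite /arc_length_prob /mscale /= /mrestr setTI lebesgue_measure_itv /=.
by rewrite lte_fin gt0 EFinN sube0 -EFinM mulVf.
Qed.

HB.instance Definition _ := @Measure_isProbability.Build _ _ _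
  arc_length_prob arc_length_prob_setT.

End arc_length_prob.

Section angle_prob.
Context {R : realType}.

Definition angle_prob (B : set (measurableTypeR R)) : \bar R :=
  ((2^-1)%:E *
   \int[lebesgue_measure]_(theta in B `&` `]0%R, pi[) (sin theta)%:E)%E.

Local Notation mu := (@lebesgue_measure R).

Let sinE B : (\int[mu]_(theta in B `&` `]0%R, (@pi R)[) (sin theta)%:E =
  \int[mu]_(theta in B) ((EFin \o @sin R) \_ `]0%R, (@pi R)[) theta)%E.
Proof. by rewrite integral_mkcondr. Qed.

Let sin_restr_ge0 x : (0 <= ((EFin \o @sin R) \_ `]0%R, (@pi R)[) x)%E.
Proof.
apply: erestrict_ge0 => y /=; rewrite in_itv /= => /andP[y0 ypi].
by rewrite lee_fin sin_ge0_pi// !ltW.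
Qed.

Let msin : measurable_fun [set: R] (@sin R).
Proof. by apply: continuous_measurable_fun; exact: continuous_sin. Qed.

Let angle_prob0 : angle_prob set0 = 0%E.
Proof. by rewrite /angle_prob set0I integral_set0 mule0. Qed.

Let angle_prob_ge0 B : (0 <= angle_prob B)%E.
Proof.
rewrite /angle_prob sinE mule_ge0 ?lee_fin//.
by apply: integral_ge0 => x _; exact: sin_restr_ge0.
Qed.

Let angle_prob_sigma_additive : semi_sigma_additive angle_prob.
Proof.
move=> F mF tF mUF; apply: cvg_toP.
  apply: ereal_nondecreasing_is_cvgn => m n mn.
  by apply: lee_sum_nneg_natr => // k _ _; exact: angle_prob_ge0.
rewrite {2}/angle_prob sinE ge0_integral_bigcup//=.
- rewrite -nneseriesZl//; last first.
    by move=> n _; apply: integral_ge0 => x _; exact: sin_restr_ge0.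
  by apply: congr_lim; apply/funext => n; apply: eq_bigr => i _; rewrite -sinE.
- apply: measurable_funTS; apply/(measurable_restrictT _ _).1 => //.
  by apply/measurable_EFinP; exact: measurable_funTS.
Qed.

HB.instance Definition _ := isMeasure.Build _ _ _ angle_prob
  angle_prob0 angle_prob_ge0 angle_prob_sigma_additive.

Let angle_prob_setT : angle_prob setT = 1%:E.
Proof.
rewrite /angle_prob setTI -(@integral_itv_bndoo _ _ _ _ true false); last first.
  by apply/measurable_EFinP; exact: measurable_funTS.
rewrite (@continuous_FTC2 _ _ (fun x => - cos x)) ?pi_gt0//.
- by rewrite cospi cos0 opprK -EFinB -EFinM opprK mulVf.
- by apply: continuous_subspaceT; exact: continuous_sin.
- split => //.
  + by apply: cvg_at_right_filter; apply: cvgN; exact: continuous_cos.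
  + by apply: cvg_at_left_filter; apply: cvgN; exact: continuous_cos.
- by move=> x _; rewrite derive1E derive_val opprK.
Qed.

HB.instance Definition _ := @Measure_isProbability.Build _ _ _
  angle_prob angle_prob_setT.

End angle_prob.

Section feres.
Context {R : realType} (alpha : R).
Implicit Types a theta : R.

(* 1 / tan (pi / 2) = 0 holds in the library, since tan (pi / 2) = 0 and
   0^-1 = 0. *)
Definition feres_u a theta : R := 2^-1 * (1 + tan a / tan theta).

Definition feres_T1 theta : R := theta + 2 * alpha.
Definition feres_T2 theta : R := - theta + 2 * pi - 4 * alpha.
Definition feres_T3 theta : R := theta - 2 * alpha.
Definition feres_T4 theta : R := - theta + 4 * alpha.

Definition feres_p1 theta : R :=
  if theta < alpha then 1
  else if theta < pi - 3 * alpha then feres_u alpha theta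
  else if theta < pi - 2 * alpha then
    2 * cos (2 * alpha) * feres_u (2 * alpha) theta
  else 0.

Definition feres_p2 theta : R :=
  if theta < pi - 3 * alpha then 0
  else if theta < pi - 2 * alpha then
    feres_u alpha theta - 2 * cos (2 * alpha) * feres_u (2 * alpha) theta
  else if theta < pi - alpha then feres_u alpha theta
  else 0.

Definition feres_p3 theta : R :=
  if theta < 2 * alpha then 0
  else if theta < 3 * alpha then
    2 * cos (2 * alpha) * feres_u (2 * alpha) (- theta)
  else if theta < pi - alpha then feres_u alpha (- theta)
  else 1.

Definition feres_p4 theta : R :=
  if theta < alpha then 0
  else if theta < 2 * alpha then feres_u alpha (- theta)
  else if theta < 3 * alpha then
    feres_u alpha (- theta)
    - 2 * cos (2 * alpha) * feres_u (2 * alpha) (- theta)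
  else 0.

Definition feres_T (i : 'I_4) : R -> R :=
  tnth [tuple feres_T1; feres_T2; feres_T3; feres_T4] i.

Definition feres_p (i : 'I_4) : R -> R :=
  tnth [tuple feres_p1; feres_p2; feres_p3; feres_p4] i.

Definition feres_bar (i : 'I_4) (x : R * R) : R * R := (x.1, feres_T i x.2).

Definition feres_bar_p (i : 'I_4) (x : R * R) : R := feres_p i x.2.

End feres.

Section invariance.
Context d (T : measurableType d) (R : realType).
Implicit Types (X : set T) (m : {measure set T -> \bar R}).

(* The state space is a measurable subset X of T, and m is seen as a measure
   on X. *)
Definition invariant_measure m X (f : T -> T) : Prop :=
  measurable_fun X f /\
  forall A, measurable A -> A `<=` X -> m (X `&` f @^-1` A) = m A.

(* The map of branch i is only used where its probability is positive: elsewhere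
   it may leave X. *)
Definition branch_domain N X (q : 'I_N -> T -> R) (i : 'I_N) : set T :=
  X `&` [set x | 0 < q i x].

(* Invariance for the random map sending x to f i x with probability q i x. The
   measurability clauses ensure that the integrals below are over measurable
   sets, of measurable functions. *)
Definition random_invariant_measure m X N (f : 'I_N -> T -> T)
    (q : 'I_N -> T -> R) : Prop :=
  [/\ forall i, measurable_fun X (q i),
      forall i, measurable_fun (branch_domain X q i) (f i) &
      forall A, measurable A -> A `<=` X ->
        m A = (\sum_(i < N)
          \int[m]_(x in branch_domain X q i `&` f i @^-1` A) (q i x)%:E)%E].

End invariance.

(* Main.v *)
Require Import Defs.
From HB Require Import structures.
From mathcomp Require Import all_boot all_order all_algebra.
From mathcomp Require Import all_classical all_reals all_analysis.
From mathcomp Require Import measurable_realfun ring lra.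

(** The Feres map is reversible: [T_1] and [T_3] are inverse to each other,
    [T_2] and [T_4] are involutions, and the weights [w_i = p_i sin] satisfy
    [w_i o T_i^-1 = w_j] on (0, pi), where [T_j = T_i^-1]. As the [T_i] preserve
    Lebesgue measure and the [w_j] sum to [sin], the law with density [sin / 2]
    is invariant. By Tonelli this holds fibrewise on the phase space; composing
    with [F], which preserves the product measure, concludes. *)

Set Implicit Arguments.
Unset Strict Implicit.
Unset Printing Implicit Defensive.

Import Order.TTheory GRing.Theory Num.Theory.
Import numFieldNormedType.Exports.

Local Open Scope classical_set_scope.
Local Open Scope ring_scope.

(** * Weights of the Feres map *)

(* Branches with inconsistent linear conditions are pruned at once, which keeps
   the case tree small. *)
Ltac split_ifs :=
  repeat (case: ifP => [|/negbT]; [|rewrite -leNgt]; intro;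
          try by exfalso; lra).

Section feres_weight.
Context {R : realType} (alpha : R).
Hypothesis halpha : 0 < alpha < pi / 6.

Lemma feres_uE (a theta : R) :
  feres_u a theta = 2^-1 * (1 + tan a * (cos theta / sin theta)).
Proof. by rewrite /feres_u {2}/tan invf_div. Qed.

(** Multiplying by [sin theta] clears the cotangent in [feres_u] and leaves the addition formula for
    the sine. *)
Lemma feres_u_sin (a theta : R) : cos a != 0 -> sin theta != 0 ->
  feres_u a theta * sin theta = sin (theta + a) / (2 * cos a).
Proof.
by move=> ca st; rewrite feres_uE sinD /tan; field; rewrite ca st.
Qed.

Lemma feres_uN_sin (a theta : R) : cos a != 0 -> sin theta != 0 ->
  feres_u a (- theta) * sin theta = sin (theta - a) / (2 * cos a).
Proof.
by move=> ca st; rewrite feres_uE sinB cosN sinN /tan; field; rewrite ca st.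
Qed.

Let cosa_gt0 : 0 < cos alpha.
Proof.
by apply: cos_gt0_pihalf; case/andP: halpha => *; apply/andP; split; lra.
Qed.

Let cos2a_gt0 : 0 < cos (2 * alpha).
Proof.
by apply: cos_gt0_pihalf; case/andP: halpha => *; apply/andP; split; lra.
Qed.

(** The only trigonometric relation between the weights: it is applied at [theta] and
    [theta ± 2 alpha] to reduce sums of weights to linear identities. *)
Lemma sin_avg x :
  (sin (x + alpha) + sin (x - alpha)) / (2 * cos alpha) = sin x.
Proof. by rewrite sinD sinB; field; rewrite gt_eqF. Qed.

(* [feres_w i] is a closed form of [feres_p alpha i * sin] on (0, pi). *)
Definition feres_w1 theta : R :=
  if theta < alpha then sin theta
  else if theta < pi - 3 * alpha then sin (theta + alpha) / (2 * cos alpha)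
  else if theta < pi - 2 * alpha then sin (theta + 2 * alpha)
  else 0.

Definition feres_w2 theta : R :=
  if theta < pi - 3 * alpha then 0
  else if theta < pi - 2 * alpha then
    - sin (theta + 3 * alpha) / (2 * cos alpha)
  else if theta < pi - alpha then sin (theta + alpha) / (2 * cos alpha)
  else 0.

Definition feres_w3 theta : R :=
  if theta < 2 * alpha then 0
  else if theta < 3 * alpha then sin (theta - 2 * alpha)
  else if theta < pi - alpha then sin (theta - alpha) / (2 * cos alpha)
  else sin theta.

Definition feres_w4 theta : R :=
  if theta < alpha then 0
  else if theta < 2 * alpha then sin (theta - alpha) / (2 * cos alpha)
  else if theta < 3 * alpha then
    - sin (theta - 3 * alpha) / (2 * cos alpha)
  else 0.

Definition feres_w (i : 'I_4) : R -> R :=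
  tnth [tuple feres_w1; feres_w2; feres_w3; feres_w4] i.

Lemma feres_p_sin i theta : sin theta != 0 ->
  feres_p alpha i theta * sin theta = feres_w i theta.
Proof.
move=> st; have ca := lt0r_neq0 cosa_gt0; have c2a := lt0r_neq0 cos2a_gt0.
have Hp : 2 * cos (2 * alpha) * feres_u (2 * alpha) theta * sin theta =
    sin (theta + 2 * alpha).
  by rewrite -mulrA feres_u_sin//; field.
have Hn : 2 * cos (2 * alpha) * feres_u (2 * alpha) (- theta) * sin theta =
    sin (theta - 2 * alpha).
  by rewrite -mulrA feres_uN_sin//; field.
rewrite /feres_p /feres_w; case: i => [[|[|[|[|//]]]] i4];
  rewrite !(tnth_nth 0)/=.
- rewrite /feres_p1 /feres_w1; case: ifP => _; first by rewrite mul1r.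
  case: ifP => _; first exact: feres_u_sin.
  by case: ifP => _; rewrite ?mul0r.
- rewrite /feres_p2 /feres_w2; case: ifP => _; first by rewrite mul0r.
  case: ifP => _.
    (* [sin (theta + 2 alpha)] splits into terms at [theta + 3 alpha] and [theta + alpha]; the
       latter cancels the [feres_u alpha] term. *)
    rewrite mulrBl feres_u_sin// Hp -(sin_avg (theta + 2 * alpha)).
    rewrite (_ : theta + _ + _ = theta + 3 * alpha); last by ring.
    rewrite (_ : theta + 2 * alpha - alpha = theta + alpha); last by ring.
    by field.
  by case: ifP => _; rewrite ?mul0r// feres_u_sin.
- rewrite /feres_p3 /feres_w3; case: ifP => _; first by rewrite mul0r.
  by do 2 case: ifP => _ //; rewrite ?mul1r// feres_uN_sin.
- rewrite /feres_p4 /feres_w4; case: ifP => _; first by rewrite mul0r.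
  case: ifP => _; first exact: feres_uN_sin.
  case: ifP => _; last by rewrite mul0r.
  rewrite mulrBl feres_uN_sin// Hn -(sin_avg (theta - 2 * alpha)).
  rewrite (_ : theta - 2 * alpha + alpha = theta - alpha); last by ring.
  rewrite (_ : theta - 2 * alpha - alpha = theta - 3 * alpha); last by ring.
  by field.
Qed.

(** On each piece the argument of the sine stays in [[0, pi]], except on the pieces with a minus
    sign: there it lies in [[pi, 2 pi]] for [feres_w2] and in [[- pi, 0]] for [feres_w4]. *)
Lemma feres_w_ge0 i theta : 0 < theta < pi -> 0 <= feres_w i theta.
Proof.
move=> /andP[t0 tpi].
have c0 : 0 <= (2 * cos alpha)^-1 by rewrite invr_ge0 mulr_ge0// ltW.
have sinN_ge0 (x : R) : - pi <= x <= 0 -> 0 <= - sin x.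
  by move=> /andP[x0 x1]; rewrite -sinN sin_ge0_pi//; apply/andP; split; lra.
have sinpiN_ge0 (x : R) : pi <= x <= pi *+ 2 -> 0 <= - sin x.
  move=> /andP[x0 x1]; rewrite -[x](subrK pi) sinDpi opprK sin_ge0_pi//.
  by apply/andP; split; lra.
rewrite /feres_w; case: i => [[|[|[|[|//]]]] i4]; rewrite !(tnth_nth 0)/=;
  rewrite ?/feres_w1 ?/feres_w2 ?/feres_w3 ?/feres_w4;
  case/andP: halpha => a0 api; move: c0 sinN_ge0 sinpiN_ge0;
  clear - t0 tpi a0 api; split_ifs; move=> c0 sinN_ge0 sinpiN_ge0.
all: rewrite ?mulr_ge0// ?sin_ge0_pi//.
all: try (apply/andP; split; lra).
  by apply: sinpiN_ge0; apply/andP; split; lra.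
by apply: sinN_ge0; apply/andP; split; lra.
Qed.

Lemma feres_p_ge0 i theta : 0 < theta < pi -> 0 <= feres_p alpha i theta.
Proof.
move=> t0; have st := sin_gt0_pi t0.
by rewrite -(pmulr_lge0 _ st) feres_p_sin ?gt_eqF// feres_w_ge0.
Qed.

(** On each piece this is a linear combination of [sin_avg] at [phi] and [phi ± 2 alpha]. As
    [alpha < pi / 6], the end zones below [3 alpha] and above [pi - 3 alpha] are disjoint. *)
Lemma feres_w_sum (phi : R) : 0 < phi < pi ->
  \sum_(i < 4) feres_w i phi = sin phi.
Proof.
move=> /andP[f0 fpi]; case/andP: (halpha) => a0 api.
rewrite !big_ord_recr big_ord0 /feres_w !(tnth_nth 0)/=.
rewrite /feres_w1 /feres_w2 /feres_w3 /feres_w4.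
have := sin_avg phi.
have := sin_avg (phi - 2 * alpha).
have := sin_avg (phi + 2 * alpha).
have -> : phi - 2 * alpha + alpha = phi - alpha by ring.
have -> : phi - 2 * alpha - alpha = phi - 3 * alpha by ring.
have -> : phi + 2 * alpha + alpha = phi + 3 * alpha by ring.
have -> : phi + 2 * alpha - alpha = phi + alpha by ring.
clear - a0 api f0 fpi.
split_ifs; move=> H1 H2 H3.
all: clear - H1 H2 H3; lra.
Qed.

(** The index of the inverse branch. Indices start at 0, so [inord 2] stands for [feres_T3]. *)
Definition feres_rev : 'I_4 -> 'I_4 :=
  tnth [tuple inord 2; inord 1; inord 0; inord 3].

Lemma feres_rev_inv : involutive feres_rev.
Proof.
move=> [[|[|[|[|//]]]] i4]; apply/val_inj;
  rewrite /feres_rev/= ?(tnth_nth ord0)/= ?inordK//=;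
  by rewrite ?(tnth_nth ord0) ?inordK.
Qed.

Lemma feres_T_rev i : cancel (feres_T alpha i) (feres_T alpha (feres_rev i)).
Proof.
move=> x; case: i => [[|[|[|[|//]]]] i4];
  rewrite /feres_rev /feres_T !(tnth_nth 0)/= ?(tnth_nth ord0)/= inordK//=;
  rewrite /feres_T1 /feres_T2 /feres_T3 /feres_T4; ring.
Qed.

(** Detailed balance. The inverse branch carries the pieces of one weight onto those of the other,
    up to endpoints; where it leaves [(0, pi)], the weight on the right vanishes. *)
Lemma feres_w_rev i (phi : R) : 0 < phi < pi ->
  (if 0 < feres_T alpha (feres_rev i) phi < pi
   then feres_w i (feres_T alpha (feres_rev i) phi) else 0) =
  feres_w (feres_rev i) phi.
Proof.
move=> /andP[f0 fpi]; case/andP: (halpha) => a0 api.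
(* Nested conditionals expose each inequality separately to [split_ifs]. *)
have andbE (b1 b2 : bool) (x : R) :
  (if b1 && b2 then x else 0) = (if b1 then if b2 then x else 0 else 0).
  by case: b1.
rewrite andbE; case: i => [[|[|[|[|//]]]] i4];
  rewrite /feres_rev /feres_T /feres_w !(tnth_nth 0)/=;
  rewrite ?(tnth_nth ord0)/= inordK//=.
- rewrite /feres_T3 /feres_w1 /feres_w3.
  have -> : phi - 2 * alpha + alpha = phi - alpha by ring.
  have -> : phi - 2 * alpha + 2 * alpha = phi by ring.
  (* At [phi = 2 alpha] the preimage is 0, outside the open interval, so the left side is 0 and the
     weight has to vanish. *)
  have : phi = 2 * alpha -> sin (phi - 2 * alpha) = 0.
    by move=> ->; rewrite subrr sin0.
  clear - a0 api f0 fpi.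
  by split_ifs; move=> // -> //; lra.
- rewrite /feres_T2 /feres_w2.
  have -> : sin (- phi + 2 * pi - 4 * alpha + 3 * alpha) = - sin (phi + alpha).
    rewrite -sinN -[RHS]sinD2pi; congr sin; ring.
  have -> : sin (- phi + 2 * pi - 4 * alpha + alpha) = - sin (phi + 3 * alpha).
    rewrite -sinN -[RHS]sinD2pi; congr sin; ring.
  (* A reflection turns half-open pieces [[a, b)] into [(a', b']]. The two sides then use different
     pieces at the three breakpoints, where continuity of the weight reconciles them. *)
  have : phi = pi - alpha -> sin (phi + alpha) = 0.
    by move=> ->; rewrite subrK sinpi.
  have : phi = pi - 2 * alpha -> - sin (phi + 3 * alpha) = sin (phi + alpha).
    move=> ->; rewrite -sinN -[LHS]sinD2pi; congr sin; ring.
  have : phi = pi - 3 * alpha -> - sin (phi + 3 * alpha) = 0.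
    by move=> ->; rewrite subrK sinpi oppr0.
  rewrite opprK; clear - a0 api f0 fpi.
  by split_ifs; move=> // e1 e2 e3;
    first [by rewrite e1 ?mul0r//; lra | by rewrite e2 ?mul0r//; lra
          |by rewrite e3 ?mul0r//; lra].
- rewrite /feres_T1 /feres_w3 /feres_w1.
  have -> : phi + 2 * alpha - alpha = phi + alpha by ring.
  have -> : phi + 2 * alpha - 2 * alpha = phi by ring.
  by clear - a0 api f0 fpi; split_ifs.
- rewrite /feres_T4 /feres_w4.
  have -> : sin (- phi + 4 * alpha - alpha) = - sin (phi - 3 * alpha).
    rewrite -sinN; congr sin; ring.
  have -> : sin (- phi + 4 * alpha - 3 * alpha) = - sin (phi - alpha).
    rewrite -sinN; congr sin; ring.
  have : phi = alpha -> sin (phi - alpha) = 0.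
    by move=> ->; rewrite subrr sin0.
  have : phi = 2 * alpha -> - sin (phi - 3 * alpha) = sin (phi - alpha).
    move=> ->; rewrite -sinN; congr sin; ring.
  have : phi = 3 * alpha -> - sin (phi - 3 * alpha) = 0.
    by move=> ->; rewrite subrr sin0 oppr0.
  rewrite opprK; clear - a0 api f0 fpi.
  by split_ifs; move=> // e1 e2 e3;
    first [by rewrite e1 ?mul0r//; lra | by rewrite e2 ?mul0r//; lra
          |by rewrite e3 ?mul0r//; lra].
Qed.

Lemma feres_T_phase i theta : 0 < theta < pi -> 0 < feres_p alpha i theta ->
  0 < feres_T alpha i theta < pi.
Proof.
move=> t0 p0; have st := sin_gt0_pi t0.
have : 0 < feres_w i theta by rewrite -feres_p_sin ?gt_eqF// mulr_gt0.
case/andP: t0 => t0 tpi; case/andP: (halpha) => a0 api.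
rewrite /feres_w /feres_T; case: i {p0} => [[|[|[|[|//]]]] i4];
  rewrite !(tnth_nth 0)/=.
- rewrite /feres_w1 /feres_T1; clear - t0 tpi a0 api.
  by split_ifs; rewrite ?ltxx// => _; apply/andP; split; lra.
- rewrite /feres_w2 /feres_T2; clear - t0 tpi a0 api.
  by split_ifs; rewrite ?ltxx// => _; apply/andP; split; lra.
- rewrite /feres_w3 /feres_T3.
  (* The endpoint [2 alpha] is sent to 0, outside [(0, pi)], but its weight is zero. *)
  have : theta = 2 * alpha -> sin (theta - 2 * alpha) = 0.
    by move=> ->; rewrite subrr sin0.
  clear - t0 tpi a0 api.
  by split_ifs; rewrite ?ltxx// => e w0; apply/andP; split; lra.
- rewrite /feres_w4 /feres_T4; clear - t0 tpi a0 api.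
  by split_ifs; rewrite ?ltxx// => _; apply/andP; split; lra.
Qed.

End feres_weight.

(** * Lebesgue measure and densities *)

(** By uniqueness of Lebesgue measure, it is enough to compare the pushforward on intervals []a,
    b]]. *)
Lemma lebesgue_measure_shift (R : realType) (c : R)
    (A : set (measurableTypeR R)) : measurable A ->
  lebesgue_measure ((fun x => x + c) @^-1` A) = lebesgue_measure A.
Proof.
have mS : measurable_fun [set: measurableTypeR R]
    (fun x => x + c : measurableTypeR R).
  by apply: measurable_funD.
pose S : {mfun measurableTypeR R >-> measurableTypeR R} :=
  HB.pack (fun x => x + c : measurableTypeR R)
    (isMeasurableFun.Build _ _ _ _ _ mS).
move=> mA; rewrite -[LHS]/(pushforward lebesgue_measure S A).
apply/esym/lebesgue_measure_unique => //= _ [[a b]] _ <-.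
rewrite /pushforward.
have -> : S @^-1` `]a, b]%classic = `]a - c, b - c]%classic.
  by apply/seteqP; split => x; rewrite /= !in_itv /= ltrBlDr lerBrDr.
rewrite !lebesgue_measure_itv/= !lte_fin ltrD2r.
by rewrite -!EFinB opprB addrA subrK.
Qed.

(** Change of variables, [mu] being its own pushforward under [phi]. *)
Lemma ge0_integral_measure_preserving d (X : measurableType d) (R : realType)
    (mu : {measure set X -> \bar R}) (phi : X -> X) :
  measurable_fun setT phi ->
  (forall A, measurable A -> mu (phi @^-1` A) = mu A) ->
  forall f : X -> \bar R, measurable_fun setT f -> (forall x, 0 <= f x)%E ->
  (\int[mu]_x f (phi x) = \int[mu]_x f x)%E.
Proof.
move=> mphi phimu f mf f0.
have := @ge0_integral_pushforward _ _ X X R phi mphi mu setT f measurableT mf.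
rewrite preimage_setT => <-; last by move=> x _.
by apply: eq_measure_integral => //= A mA _; rewrite -phimu.
Qed.

Section density.
Local Open Scope ereal_scope.
Context d (T : measurableType d) (R : realType).
Variables (nu : {finite_measure set T -> \bar R})
  (mu : {sigma_finite_measure set T -> \bar R}) (g : T -> \bar R).
Hypotheses (mg : measurable_fun setT g)
  (nuE : forall A, measurable A -> nu A = \int[mu]_(x in A) g x).

(** The Radon-Nikodym derivative of [nu] has the same integral as [g] over every measurable set,
    hence equals [g] almost everywhere. *)
Lemma ge0_integral_density f : measurable_fun setT f -> (forall x, 0 <= f x) ->
  \int[nu]_x f x = \int[mu]_x (f x * g x).
Proof.
move=> mf f0.
have numu : nu `<< mu.
  apply/null_content_dominatesP => A mA A0.
  by rewrite nuE// null_set_integral//; exact: measurable_funTS.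
rewrite -(Radon_Nikodym_SigmaFinite.change_of_variables numu)//.
have ffin := Radon_Nikodym_SigmaFinite.f_integrable numu.
have mf' := measurable_int _ ffin.
apply: ae_eq_integral => //; [exact: emeasurable_funM|exact: emeasurable_funM|].
apply: ae_eqe_mul2l; apply: integral_ae_eq => // E _ mE.
by rewrite -nuE// -Radon_Nikodym_SigmaFinite.f_integral.
Qed.

End density.

(** * Invariance of the angular law *)

Lemma measurable_invr (R : realType) : measurable_fun [set: R] (@GRing.inv R).
Proof.
pose f : R -> R := fun x => x^-1.
(* Since [0^-1 = 0], inversion is the extension by zero of its restriction to an open set where it
   is continuous. *)
have -> : @GRing.inv R = f \_ [set x | x != 0].
  apply/funext => x; rewrite patchE; case: ifPn => // /negP.
  by rewrite inE/= => /negP; rewrite negbK => /eqP ->; rewrite invr0.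
have o0 : open [set x : R | x != 0] by exact: open_neq.
apply/(@measurable_restrictT _ _ _ _ _ f).
  exact: open_measurable.
apply: open_continuous_measurable_fun => // x; rewrite inE => x0.
exact: inv_continuous.
Qed.

Section feres_measure.
Context {R : realType} (alpha : R).
Local Notation mu := (@lebesgue_measure R).

Lemma measurable_feres_p i : measurable_fun [set: R] (feres_p alpha i).
Proof.
have mlt c : measurable_fun [set: R] (fun x : R => x < c).
  by apply: measurable_fun_ltr.
have msin : measurable_fun [set: R] (@sin R).
  by apply: continuous_measurable_fun; exact: continuous_sin.
have mcos : measurable_fun [set: R] (@cos R).
  by apply: continuous_measurable_fun; exact: continuous_cos.
have mu_ a : measurable_fun [set: R] (feres_u a).
  apply: (eq_measurable_fun (fun t => 2^-1 * (1 + tan a * (cos t / sin t)))).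
    by move=> t _; rewrite feres_uE.
  apply: measurable_funM => //; apply: measurable_funD => //.
  apply: measurable_funM => //; apply: measurable_funM => //.
  by apply: measurableT_comp => //; exact: measurable_invr.
have muN a : measurable_fun [set: R] (fun t => feres_u a (- t)).
  exact: measurableT_comp.
have mcu c a : measurable_fun [set: R] (fun t => c * feres_u a t).
  exact: measurable_funM.
have mcuN c a : measurable_fun [set: R] (fun t => c * feres_u a (- t)).
  exact: measurable_funM.
rewrite /feres_p; case: i => [[|[|[|[|//]]]] i4]; rewrite (tnth_nth (cst 0))/=;
  repeat (apply: measurable_fun_ifT => //); exact: measurable_funB.
Qed.

Lemma measurable_feres_T i : measurable_fun [set: R] (feres_T alpha i).
Proof.
rewrite /feres_T; case: i => [[|[|[|[|//]]]] i4]; rewrite (tnth_nth id)/=;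
  rewrite /feres_T1 /feres_T2 /feres_T3 /feres_T4;
  by repeat apply: measurable_funD.
Qed.

Lemma lebesgue_feres_T i (A : set (measurableTypeR R)) : measurable A ->
  mu (feres_T alpha i @^-1` A) = mu A.
Proof.
move=> mA; have mS c : measurable ((fun x : R => x + c) @^-1` A).
  rewrite -[X in measurable X]setTI; apply: measurable_funD => //.
have muN c : mu ((fun x => - x + c) @^-1` A) = mu A.
  by rewrite -(lebesgue_measure_shift c mA) -[RHS]lebesgue_measureN.
rewrite /feres_T; case: i => [[|[|[|[|//]]]] i4]; rewrite (tnth_nth id)/=.
- exact: lebesgue_measure_shift.
- rewrite -(muN (2 * pi - 4 * alpha)); congr (mu (_ @^-1` A)).
  by apply/funext => x; rewrite /feres_T2 addrA.
- exact: lebesgue_measure_shift.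
- exact: muN.
Qed.

(** Extended by zero, so that integrals run over the whole line, on which the branches are
    bijections preserving Lebesgue measure. *)
Definition angle_density (theta : R) : R :=
  ((fun t => 2^-1 * sin t) \_ `]0, pi[) theta.

Lemma measurable_angle_density : measurable_fun [set: R] angle_density.
Proof.
have m : measurable_fun [set: R] (fun t : R => 2^-1 * sin t).
  apply: measurable_funM => //.
  by apply: continuous_measurable_fun; exact: continuous_sin.
have mI : measurable (`]0, pi[%classic : set R) by exact: measurable_itv.
exact: (measurable_restrictT _ mI).1 (measurable_funTS m).
Qed.

Lemma angle_probE (A : set (measurableTypeR R)) : measurable A ->
  angle_prob A = (\int[mu]_(x in A) (angle_density x)%:E)%E.
Proof.
move=> mA; rewrite /angle_prob integral_mkcondr -ge0_integralZl//=.
- apply: eq_integral => x _; rewrite /angle_density !patchE.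
  by case: ifPn => _; [rewrite -EFinM|exact: mule0].
- apply: measurable_funTS; apply/(measurable_restrictT _ _).1 => //.
  apply/measurable_EFinP; apply: measurable_funTS.
  by apply: continuous_measurable_fun; exact: continuous_sin.
- move=> x _; apply: erestrict_ge0 => y /=; rewrite in_itv/= => /andP[y0 ypi].
  by rewrite lee_fin sin_ge0_pi// !ltW.
Qed.

Hypothesis halpha : 0 < alpha < pi / 6.

(** When [B] is a section of a subset of the phase space, this is the corresponding section of the
    integration domain of branch [i]. *)
Definition feres_branch i (B : set R) : set R :=
  `]0, pi[ `&` [set t | 0 < feres_p alpha i t] `&` feres_T alpha i @^-1` B.

Let angleE theta : (theta \in (`]0, pi[%classic : set R)) = (0 < theta < pi).
Proof. by apply/idP/idP; rewrite inE/= in_itv/=. Qed.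

(** Detailed balance makes the integrand of a branch a function of [feres_T alpha i theta] alone,
    ready for the change of variables. *)
Lemma feres_branch_density i (B : set R) theta : B `<=` `]0, pi[ ->
  (feres_p alpha i \_ (feres_branch i B)) theta * angle_density theta =
  ((fun t => 2^-1 * feres_w alpha (feres_rev i) t) \_ B)
    (feres_T alpha i theta).
Proof.
move=> Bpi; rewrite [in RHS]patchE; case: ifPn => TB; last first.
  rewrite patchE ifN ?mul0r//; apply: contra TB.
  by rewrite !inE => -[].
move: TB; rewrite inE => TB.
have := Bpi _ TB; rewrite /= in_itv/= => Tpi.
rewrite -feres_w_rev// feres_T_rev /angle_density !patchE.
rewrite angleE; case: (boolP (0 < theta < pi)) => t0; last by rewrite !mulr0.
have st : sin theta != 0 by rewrite gt_eqF// sin_gt0_pi.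
rewrite -feres_p_sin//.
case: ifPn => [_|C]; first by ring.
(* Here [theta] is in [(0, pi)] and its image in [B], so [theta] can be outside the branch only by
   having probability zero. *)
suff -> : feres_p alpha i theta = 0 by rewrite !mul0r mulr0.
apply/eqP; rewrite eq_le feres_p_ge0// andbT leNgt; apply: contra C => p0.
by rewrite inE /feres_branch/= in_itv.
Qed.

Lemma measurable_feres_branch i (B : set R) : measurable B ->
  measurable (feres_branch i B).
Proof.
move=> mB; apply: measurableI; first apply: measurableI => //.
- rewrite (_ : mkset _ = feres_p alpha i @^-1` `]0, +oo[%classic).
    by rewrite -[X in measurable X]setTI; exact: measurable_feres_p.
  by apply/seteqP; split=> x; rewrite /= in_itv/= andbT.
- by rewrite -[X in measurable X]setTI; exact: measurable_feres_T.
Qed.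

Lemma feres_p_branch_ge0 i (B : set R) x :
  0 <= (feres_p alpha i \_ (feres_branch i B)) x.
Proof.
by rewrite patchE; case: ifPn => //; rewrite inE => -[[/= _ /ltW]].
Qed.

Lemma measurable_feres_p_branch i (B : set R) : measurable B ->
  measurable_fun [set: R] (feres_p alpha i \_ (feres_branch i B)).
Proof.
move=> mB; have mC := measurable_feres_branch i mB.
exact: (measurable_restrictT _ mC).1 (measurable_funTS (measurable_feres_p i)).
Qed.

Lemma feres_angle_invariant (B : set (measurableTypeR R)) :
  measurable B -> B `<=` `]0, pi[ ->
  (\sum_(i < 4) \int[angle_prob]_t
     ((feres_p alpha i \_ (feres_branch i B)) t)%:E)%E = angle_prob B.
Proof.
move=> mB Bpi.
have Hge i x :
    0 <= ((fun t => 2^-1 * feres_w alpha (feres_rev i) t) \_ B) x :> R.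
  rewrite patchE; case: ifPn => //.
  rewrite inE => /Bpi/=; rewrite in_itv/= => x0.
  by rewrite mulr_ge0// feres_w_ge0.
have mw i : measurable_fun [set: R]
    ((fun t => 2^-1 * feres_w alpha (feres_rev i) t) \_ B).
  apply: (measurable_restrictT _ mB).1.
  (* On [B], measurability of the weight comes from that of [feres_p] times the sine. *)
  apply: (eq_measurable_fun
    (fun t => 2^-1 * (feres_p alpha (feres_rev i) t * sin t))).
    move=> t; rewrite inE => /Bpi/=; rewrite in_itv/= => t0.
    by rewrite feres_p_sin// gt_eqF// sin_gt0_pi.
  apply: measurable_funTS; apply: measurable_funM => //.
  apply: measurable_funM; first exact: measurable_feres_p.
  by apply: continuous_measurable_fun; exact: continuous_sin.
(* Branch by branch: pass to Lebesgue measure, factor the integrand through [feres_T alpha i], and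
   drop this map by invariance of [mu]. *)
transitivity (\sum_(i < 4) \int[mu]_t
    (((fun t => 2^-1 * feres_w alpha (feres_rev i) t) \_ B) t)%:E)%E.
  apply: eq_bigr => i _.
  rewrite (@ge0_integral_density _ _ _ angle_prob mu
      (fun x => (angle_density x)%:E)).
  - under eq_integral do rewrite -EFinM feres_branch_density//.
    apply: (@ge0_integral_measure_preserving _ (measurableTypeR R) R mu
      (feres_T alpha i) (measurable_feres_T i) (@lebesgue_feres_T i)
      (EFin \o ((fun t => 2^-1 * feres_w alpha (feres_rev i) t) \_ B))).
      by apply/measurable_EFinP; exact: mw.
    by move=> x; rewrite lee_fin Hge.
  - by apply/measurable_EFinP; exact: measurable_angle_density.
  - by move=> A mA; exact: angle_probE.
  - by apply/measurable_EFinP; exact: measurable_feres_p_branch.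
  - by move=> x; rewrite lee_fin feres_p_branch_ge0.
rewrite -ge0_integral_sum//; last 2 first.
- by move=> i; apply/measurable_EFinP; exact: mw.
- by move=> i x _; rewrite lee_fin Hge.
rewrite angle_probE// [RHS]integral_mkcond; apply: eq_integral => t _.
rewrite sumEFin [RHS]patchE; case: ifPn => tB; last first.
  by rewrite big1// => i _; rewrite patchE ifN.
congr EFin; move: (tB); rewrite inE => /Bpi/=; rewrite in_itv/= => t0.
under eq_bigr do rewrite patchE tB.
(* [feres_rev] permutes the branches, so the reversed weights also sum to the sine. *)
have <- : \sum_(i < 4) 2^-1 * feres_w alpha i t =
    \sum_(i < 4) 2^-1 * feres_w alpha (feres_rev i) t.
  exact: (reindex_inj (can_inj feres_rev_inv)).
rewrite -mulr_sumr.
by rewrite feres_w_sum// /angle_density patchE ifT// angleE.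
Qed.

End feres_measure.

(** * Invariance on the phase space *)

Section product.
Context {R : realType} (L : {posnum R}) (alpha : R).
Hypothesis halpha : 0 < alpha < pi / 6.
Local Notation X := (phase_space L%:num).
Local Notation m := (arc_length_prob L \x angle_prob)%E.

Lemma measurable_phase_space :
  measurable (X : set (measurableTypeR R * measurableTypeR R)).
Proof. by apply: measurableX. Qed.

Lemma measurable_feres_bar_p i :
  measurable_fun [set: measurableTypeR R * measurableTypeR R]
    (feres_bar_p alpha i).
Proof.
exact: (measurableT_comp (measurable_feres_p alpha i) measurable_snd).
Qed.

Lemma measurable_feres_bar i :
  measurable_fun [set: measurableTypeR R * measurableTypeR R]
    (feres_bar alpha i : _ -> measurableTypeR R * measurableTypeR R).
Proof.
apply: measurable_fun_pair; first exact: measurable_fst.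
exact: (measurableT_comp (measurable_feres_T alpha i) measurable_snd).
Qed.

Lemma measurable_branch_domain i :
  measurable (branch_domain X (feres_bar_p alpha) i
    : set (measurableTypeR R * measurableTypeR R)).
Proof.
apply: measurableI; first exact: measurable_phase_space.
rewrite (_ : mkset _ = feres_bar_p alpha i @^-1` `]0, +oo[%classic).
  by rewrite -[X in measurable X]setTI; exact: measurable_feres_bar_p.
by apply/seteqP; split=> x; rewrite /= in_itv/= andbT.
Qed.

Lemma feres_bar_invariant (B : set (measurableTypeR R * measurableTypeR R)) :
  measurable B -> B `<=` X ->
  m B = (\sum_(i < 4) \int[m]_(x in branch_domain X (feres_bar_p alpha) i
           `&` feres_bar alpha i @^-1` B) (feres_bar_p alpha i x)%:E)%E.
Proof.
move=> mB BX.
pose E i := branch_domain X (feres_bar_p alpha) i `&` feres_bar alpha i @^-1` B.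
have mE i : measurable (E i).
  apply: measurableI; first exact: measurable_branch_domain.
  by rewrite -[X in measurable X]setTI; exact: measurable_feres_bar.
(* Extension by zero moves the integrals to the whole product, where Tonelli applies. *)
pose f i x := ((feres_bar_p alpha i \_ (E i)) x)%:E.
have f0 i x : (0 <= f i x)%E.
  rewrite lee_fin patchE; case: ifPn => //.
  by rewrite inE => -[[_ /= /ltW]].
have mf i : measurable_fun setT (f i).
  apply/measurable_EFinP.
  exact: (measurable_restrictT _ (mE i)).1
    (measurable_funTS (measurable_feres_bar_p i)).
transitivity (\sum_(i < 4) \int[m]_x f i x)%E; last first.
  apply: eq_bigr => i _; rewrite [RHS]integral_mkcond.
  by apply: eq_integral => x _; rewrite /f !patchE; case: ifPn.
have fubini i : (\int[m]_x f i x =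
    \int[arc_length_prob L]_s fubini_F angle_prob (f i) s)%E.
  exact: (@fubini_tonelli1 _ _ _ _ _ (arc_length_prob L) angle_prob (f i)
    (mf i) (f0 i)).
under eq_bigr do rewrite fubini.
rewrite -ge0_integral_sum//; last 2 first.
- move=> i; exact: (@measurable_fun_fubini_tonelli_F _ _ _ _ _ angle_prob (f i)
    (mf i) (f0 i)).
- by move=> i x _; apply: integral_ge0 => y _; exact: f0.
rewrite [LHS]/product_measure1; apply: eq_integral => s _ /=.
have Bs : xsection B s `<=` `]0, pi[.
  by move=> t; rewrite /xsection/= inE => /BX[].
rewrite -(feres_angle_invariant halpha _ Bs); last first.
  exact: measurable_xsection.

apply: eq_bigr => i _; rewrite /fubini_F; apply: eq_integral => t _.
rewrite /f; congr EFin; rewrite !patchE /feres_bar_p /=.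
congr (if _ then _ else _).
(* The two domains agree on the fibre over [s]; the condition that [s] lies in [[0, L)] is recovered
   from [B] being inside the phase space. *)
apply/idP/idP; rewrite !inE.
- move=> [[It pt] Tt]; have Bt : B (s, feres_T alpha i t).
    by move: Tt; rewrite /= /xsection/= inE.
  by split => //; split => //; split => //=; have [] := BX _ Bt.
- move=> [[[_ It] pt] Tt]; split=> //.
  by rewrite /= /xsection /= inE.
Qed.

End product.

(** * Composition with the billiard map *)

Theorem proposition4p5 (R : realType) (L : {posnum R}) (gamma : R -> R * R)
    (F : R * R -> R * R) (alpha : R)
    (hgamma : billiard_curve L%:num gamma)
    (hF : billiard_map L%:num gamma F)
    (hFinv : invariant_measure (arc_length_prob L \x angle_prob)%E
               (phase_space L%:num) F)
    (halpha : 0 < alpha < pi / 6) :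
  random_invariant_measure (arc_length_prob L \x angle_prob)%E
    (phase_space L%:num) (fun i => F \o feres_bar alpha i)
    (feres_bar_p alpha).
Proof.
have [mF Finv] := hFinv.
(* [F] is measurable and measure preserving only on the phase space, so each branch has to land
   there wherever its probability is positive. *)
have Tbar_phase i x :
    branch_domain (phase_space L%:num) (feres_bar_p alpha) i x ->
    phase_space L%:num (feres_bar alpha i x).
  case: x => s t [[/= Is It] pt]; split => //=; exact: feres_T_phase.
split.
- by move=> i; apply: measurable_funTS; exact: measurable_feres_bar_p.
- move=> i; apply: (measurable_comp (measurable_phase_space L) _ mF).
    by move=> _ [x /Tbar_phase + <-].
  by apply: measurable_funTS; exact: measurable_feres_bar.
- move=> A mA AX.
  have XX : phase_space L%:num `&` F @^-1` A `<=` phase_space L%:num.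
    by move=> x [].
  have mFA := mF (measurable_phase_space L) _ mA.
  (* Invariance under [F] replaces [A] by its preimage in the phase space, to which the invariance
     under the angular map is applied. *)
  rewrite -Finv//; apply: (etrans (feres_bar_invariant halpha mFA XX)).
  apply: eq_bigr => i _; congr (integral _ _ _).
  apply/seteqP; split => x [Dx]/=; first by move=> [].
  by move=> FA; split => //; split => //; exact: Tbar_phase.
Qed.
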